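(* Let $k \geq 1$ be an integer. A real sequence $(c_n)_{n \in \mathbb{Z}}$ is a $TP_k$ Pólya frequency sequence if and only if for all integers $r \in \{1,\dots,k\}$ and $l \in \mathbb{Z}$, and all $x \in \mathbb{R}^r_{\rm alt}$, there exists $j_0 \in \{1,\dots,r\}$ such that $$x_{j_0} \sum_{j=1}^r c_{l + j_0 - j}\, x_j > 0.$$
   Context: A real sequence $(c_n)_{n \in \mathbb{Z}}$ is a $TP_k$ Pólya frequency sequence if for all integers $r \in \{1,\dots,k\}$, $m_1 < \cdots < m_r$ and $n_1 < \cdots < n_r$ (all $m_i, n_j \in \mathbb{Z}$), the determinant $\det (c_{m_i - n_j})_{i,j=1}^r$ is positive. For an integer $r \geq 1$, $\mathbb{R}^r_{\rm alt} \subset \mathbb{R}^r$ is the set of vectors all of whose components are nonzero and have alternating signs (consecutive components have opposite signs; for $r=1$, all nonzero reals). *)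

(* Defs.v *)
From HB Require Import structures.
From mathcomp Require Import all_boot all_order all_algebra.
From mathcomp Require Import reals.

Set Implicit Arguments.
Unset Strict Implicit.
Unset Printing Implicit Defensive.

Import Order.TTheory GRing.Theory Num.Theory.

Local Open Scope ring_scope.

Definition strictly_increasing (r : nat) (m : 'I_r -> int) : Prop :=
  forall i j : 'I_r, (i < j)%N -> m i < m j.

(* Strict total positivity of order k: minors are required to be > 0, not
   merely >= 0. *)
Definition TP_Polya_frequency (R : realType) (k : nat) (c : int -> R) : Prop :=
  forall r : nat, (1 <= r <= k)%N ->
  forall m n : 'I_r -> int, strictly_increasing m -> strictly_increasing n ->
  0 < \det (\matrix_(i < r, j < r) c (m i - n j)).

Definition alternating (R : realType) (r : nat) (x : 'cV[R]_r) : Prop :=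
  (forall i : 'I_r, x i 0 != 0) /\
  (forall i j : 'I_r, j = i.+1 :> nat -> Num.sg (x j 0) = - Num.sg (x i 0)).

(* Main.v *)
(* If c is TP_k, a matrix A = (c_(l+i-j)) of order at most k has positive
   principal minors. If x_j (A x)_j <= 0 for all j, with no x_j zero, then
   (A + D) x = 0 for some diagonal D >= 0, contradicting det (A + D) > 0.
   Conversely, if all minors of order r are positive, the cofactors of the first
   row of a contiguous A of order r+1 form an alternating x, and A x has det A
   as its first entry and 0 elsewhere, so sign non-reversal forces det A > 0.
   Fekete's argument (Pluecker relation and induction on the dispersion of the
   rows, then of the columns) passes from contiguous minors of order r+1 to all
   of them. *)
Require Import Defs.
From mathcomp Require Import all_boot all_order all_algebra.
From mathcomp Require Import reals.
From mathcomp Require Import zify.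

Set Implicit Arguments.
Unset Strict Implicit.
Unset Printing Implicit Defensive.

Import Order.TTheory GRing.Theory Num.Theory.

Local Open Scope ring_scope.

(** Indices are functions on [nat] rather than on ordinals, so that omitting a row or column is
    composition with [bump]; only the values below [r] matter. *)
Definition minor (R : comPzRingType) (T U : Type) (a : T -> U -> R) (r : nat)
    (f : nat -> T) (g : nat -> U) : R :=
  \det (\matrix_(i < r, j < r) a (f i) (g j)).

(** * Laplace expansions and relations between minors *)

Section Minors.
Variables (R : comPzRingType) (T U : Type).
Implicit Types (a : T -> U -> R) (f : nat -> T) (g : nat -> U).

Lemma eq_minor a r f f' g g' :
  (forall i, (i < r)%N -> f i = f' i) -> (forall j, (j < r)%N -> g j = g' j) ->
  minor a r f g = minor a r f' g'.
Proof.
move=> ef eg; congr (\det _); apply/matrixP => i j.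
by rewrite !mxE ef ?eg.
Qed.

Lemma minor_tr a r f g : minor (fun u t => a t u) r g f = minor a r f g.
Proof.
rewrite /minor -det_tr; congr (\det _); apply/matrixP => i j.
by rewrite !mxE.
Qed.

Lemma minor0 a f g : minor a 0 f g = 1.
Proof. by rewrite /minor det_mx00. Qed.

Lemma cofactor_minor a r f g (i0 j0 : 'I_r.+1) :
  cofactor (\matrix_(i < r.+1, j < r.+1) a (f i) (g j)) i0 j0 =
  (-1) ^+ (i0 + j0) * minor a r (f \o bump i0) (g \o bump j0).
Proof.
rewrite /cofactor /minor; congr (_ * \det _).
by apply/matrixP => i j; rewrite !mxE.
Qed.

Lemma minor_expand_row a r f g (i0 : 'I_r.+1) :
  minor a r.+1 f g =
  \sum_(j < r.+1) a (f i0) (g j) *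
    ((-1) ^+ (i0 + j) * minor a r (f \o bump i0) (g \o bump j)).
Proof.
rewrite {1}/minor (expand_det_row _ i0); apply: eq_bigr => j _.
by rewrite (cofactor_minor a f g) mxE.
Qed.

Lemma minor_expand_col a r f g (j0 : 'I_r.+1) :
  minor a r.+1 f g =
  \sum_(i < r.+1) a (f i) (g j0) *
    ((-1) ^+ (i + j0) * minor a r (f \o bump i) (g \o bump j0)).
Proof.
rewrite {1}/minor (expand_det_col _ j0); apply: eq_bigr => i _.
by rewrite (cofactor_minor a f g) mxE.
Qed.

Lemma minor_repeated_row a r f g i1 i2 :
  (i1 < i2 < r)%N -> f i1 = f i2 -> minor a r f g = 0.
Proof.
case/andP=> lt12 lt2 ef; have lt1 := ltn_trans lt12 lt2.
apply: (determinant_alternate (i1 := Ordinal lt1) (i2 := Ordinal lt2)).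
  by rewrite -val_eqE /= ltn_eqF.
by move=> j; rewrite !mxE /= ef.
Qed.

End Minors.

(* Cramer's rule for the left kernel of an (n+1) x n matrix. *)
Lemma alternating_sum_minors (R : comPzRingType) (T U : Type)
    (a : T -> U -> R) n (f : nat -> T) (g : nat -> U) j0 : (j0 < n)%N ->
  \sum_(i < n.+1) (-1) ^+ i * minor a n (f \o bump i) g * a (f i) (g j0) = 0.
Proof.
move=> lt_j0.
(* Column [j0] is repeated in front: the minor on [g'] vanishes, and its expansion along the first
   column is the sum. *)
pose g' t := if t is t'.+1 then g t' else g j0.
have: minor a n.+1 f g' = 0.
  by rewrite -minor_tr (@minor_repeated_row _ _ _ _ _ _ _ 0 j0.+1).
rewrite (minor_expand_col _ _ _ ord0) => e; rewrite -[RHS]e.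
apply: eq_bigr => i _.
by rewrite addn0 mulrC.
Qed.

(* Pluecker relation for the rows [f 0], ..., [f n.+2]: the minors of order
   [n.+2] omit row [q.+1], 0 or [n.+2], those of order [n.+1] omit the other two. *)
Lemma three_term_minors (R : comPzRingType) (T U : Type) (a : T -> U -> R) n q
    (f : nat -> T) (g : nat -> U) : (q <= n)%N ->
  minor a n.+2 (f \o bump q.+1) g * minor a n.+1 (f \o succn) g =
    minor a n.+2 (f \o succn) g * minor a n.+1 (f \o bump q.+1) g +
    minor a n.+2 f g * minor a n.+1 (f \o bump q.+1 \o succn) g.
Proof.
move=> le_qn.
(* [s] lists the rows other than 0, [q.+1] and [n.+2]; [phi t] is the minor with row [f t] placed
   before them. *)
pose s t := f (bump q.+1 t.+1).
pose D j := minor a n s (g \o bump j).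
pose phi t := \sum_(j < n.+1) a (f t) (g j) * ((-1) ^+ j * D j).
have expand (h : nat -> T) (p : 'I_n.+1) t : h p = f t ->
    (forall i, (i < n)%N -> h (bump p i) = s i) ->
    minor a n.+1 h g = (-1) ^+ p * phi t.
  move=> hp hs; rewrite (minor_expand_row _ _ _ p) mulr_sumr.
  apply: eq_bigr => j _; rewrite hp exprD /D.
  rewrite (@eq_minor _ _ _ _ _ (h \o bump p) s _ (g \o bump j)) //.
  by rewrite -!mulrA mulrCA.
have phi0 : minor a n.+1 (f \o bump q.+1) g = phi 0%N.
  by rewrite (expand _ ord0 0%N) ?expr0 ?mul1r.
have phiq : minor a n.+1 (f \o succn) g = (-1) ^+ q * phi q.+1.
  apply: (expand _ (Ordinal (le_qn : q < n.+1)%N)) => //= i _.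
  by rewrite /s /bump; congr f; lia.
have phin : minor a n.+1 (f \o bump q.+1 \o succn) g = (-1) ^+ n * phi n.+2.
  apply: (expand _ ord_max) => /= [|i lt_in].
    by rewrite /bump; congr f; lia.
  by rewrite /s /bump; congr f; lia.
have phis t : (0 < t < n.+2)%N -> t != q.+1 -> phi t = 0.
  move=> /andP[t_gt0 lt_t] t_neq.
  pose h i := if i is i'.+1 then s i' else f t.
  have := expand h ord0 t; rewrite expr0 mul1r => <- //.
  apply: (@minor_repeated_row _ _ _ _ _ _ _ 0 (unbump q.+1 t)).
    by rewrite /unbump; lia.
  rewrite /= /h /s; case E: (unbump q.+1 t) => [|u]; first by [].
  by congr f; move: E; rewrite /bump /unbump; lia.
(* [phi i] is linear in the entries of row [f i], so Cramer's rule kills the sum column by column;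
   by [phis] only the terms 0, [q.+1] and [n.+2] survive. *)
have: \sum_(i < n.+3) (-1) ^+ i * minor a n.+2 (f \o bump i) g * phi i = 0.
  rewrite /phi; under eq_bigr do rewrite mulr_sumr.
  rewrite exchange_big big1 //= => j _.
  under eq_bigr do rewrite mulrA; rewrite -mulr_suml.
  have lt_j : (j < n.+2)%N by apply: leqW.
  by rewrite (alternating_sum_minors _ _ _ lt_j) mul0r.
rewrite big_ord_recl big_ord_recr /= (bigD1 (Ordinal (le_qn : q < n.+1)%N)) //=.
rewrite big1 => [|i ne_iq]; last first.
  by rewrite phis ?mulr0 //; exact: ltn_ord i.
have -> : minor a n.+2 (f \o bump (bump 0 n.+1)) g = minor a n.+2 f g.
  by apply: eq_minor => //= i lt_i; rewrite /bump; congr f; lia.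
rewrite phi0 phiq phin addr0 ![bump 0 _]add1n -[f \o bump 0]/(f \o succn).
rewrite expr0 mul1r !exprS !mulN1r opprK !mulNr addrCA addrC => /eqP.
by rewrite subr_eq0 -!mulrA ![_ * (_ ^+ _ * phi _)]mulrCA => /eqP.
Qed.

(** * Increasing index sequences *)

Definition increasing (f : nat -> int) := {homo f : i j / (i < j)%N >-> i < j}.

Definition positive_minors (R : numDomainType) (a : int -> int -> R) r :=
  forall f g : nat -> int, increasing f -> increasing g -> 0 < minor a r f g.

Definition positive_contiguous_minors (R : numDomainType)
    (a : int -> int -> R) r :=
  forall s t : int, 0 < minor a r (fun i => s + i%:Z) (fun j => t + j%:Z).

Lemma increasing_bump f p : increasing f -> increasing (f \o bump p).
Proof. by move=> f_inc i j lt_ij; apply: f_inc; rewrite /bump; lia. Qed.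

Lemma increasing_succ f : increasing f -> increasing (f \o succn).
Proof. by move=> f_inc i j lt_ij; apply: f_inc. Qed.

Lemma increasing_shift s : increasing (fun i => s + i%:Z).
Proof. by move=> i j lt_ij; rewrite ltrD2l ltz_nat. Qed.

Definition insert_value (f : nat -> int) p v t : int :=
  if (t < p)%N then f t else if t == p then v else f t.-1.

Lemma insert_value_bump f p v t : insert_value f p v (bump p t) = f t.
Proof.
rewrite /insert_value /bump; have [le_pt|lt_tp] := leqP p t;
  last by rewrite lt_tp.
by rewrite add1n ltnNge leqW //= gtn_eqF.
Qed.

Lemma increasing_insert_value f p v : increasing f ->
  f p < v < f p.+1 -> increasing (insert_value f p.+1 v).
Proof.
move=> f_inc /andP[lt_pv lt_vp] i j lt_ij.
have f_le k l : (k <= l)%N -> f k <= f l.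
  by rewrite leq_eqVlt => /predU1P[->//|/f_inc/ltW].
rewrite /insert_value; case: (ltngtP i p.+1) => [lt_ip|lt_pi|eq_ip].
- have le_ip : f i <= f p by apply: f_le.
  case: (ltngtP j p.+1) => [lt_jp|lt_pj|eq_jp]; first exact: f_inc.
    by apply: f_inc; lia.
  exact: le_lt_trans lt_pv.
- have lt_pj := ltn_trans lt_pi lt_ij.
  by rewrite ltnNge ltnW //= gtn_eqF //; apply: f_inc; lia.
- rewrite eq_ip in lt_ij *; rewrite ltnNge ltnW //= gtn_eqF //.
  by apply: lt_le_trans lt_vp _; apply: f_le; lia.
Qed.

Lemma contiguous_or_gap f n : increasing f ->
  (forall i, (i <= n)%N -> f i = f 0%N + i%:Z) \/
  (exists2 p, (p < n)%N & f p + 1 < f p.+1).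
Proof.
move=> f_inc; elim: n => [|n [contig|[p lt_pn gap]]].
- by left=> i; rewrite leqn0 => /eqP->; rewrite addr0.
- have [gap|le_gap] := ltP (f n + 1) (f n.+1); first by right; exists n.
  left=> i; rewrite leq_eqVlt => /predU1P[->|]; last exact: contig.
  have := f_inc n n.+1 (ltnSn n); have := contig n (leqnn n); lia.
- by right; exists p => //; apply: ltnW.
Qed.

(** * Fekete's criterion *)

Section Fekete.
Variable R : realDomainType.
Implicit Types (a : int -> int -> R) (f g : nat -> int).

(* Induction on the dispersion [f n - f 0]: inserting a value in a gap of [f]
   expresses the minor through minors of order n, and two minors of order n+1
   with smaller dispersion. *)
Lemma positive_minors_contiguous_rows a n g :
  increasing g -> positive_minors a n ->
  (forall s : int, 0 < minor a n.+1 (fun i => s + i%:Z) g) ->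
  forall f, increasing f -> 0 < minor a n.+1 f g.
Proof.
move=> g_inc pos_n pos_contig f.
have [d] := ubnP `|f n - f 0%N|%N; elim: d f => // d IHd f lt_d f_inc.
have [contig|[p lt_pn gap]] := contiguous_or_gap n f_inc.
  by rewrite (@eq_minor _ _ _ _ _ f (fun i => f 0%N + i%:Z) g g).
case: n lt_pn => // n lt_pn in pos_n pos_contig IHd lt_d *.
(* [f] is [h] without entry [p.+1]. The other two minors of order [n.+2] omit an end of [h], which
   shrinks the dispersion. *)
pose h := insert_value f p.+1 (f p + 1).
have h_inc : increasing h.
  by apply: increasing_insert_value => //; rewrite gap ltrDl.
have hE t : h (bump p.+1 t) = f t by apply: insert_value_bump.
have f_ge0 : f 0%N <= f n.+1 by apply/ltW/f_inc.
have h_last : h n.+2 = f n.+1 by rewrite -hE /bump; congr h; lia.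
have h_first : h 0%N = f 0%N by rewrite -hE.
have pos_succ : 0 < minor a n.+2 (h \o succn) g.
  apply: (IHd _ _ (increasing_succ h_inc)) => /=.
  have := h_inc 0%N 1%N isT; have := h_inc 1%N n.+2 isT; lia.
have pos_h : 0 < minor a n.+2 h g.
  apply: (IHd _ _ h_inc); have := h_inc n.+1 n.+2 (ltnSn _).
  have := h_inc 0%N n.+1 isT; lia.
have := three_term_minors a h g (lt_pn : p <= n)%N.
rewrite (@eq_minor _ _ _ _ _ (h \o bump p.+1) f g g) //;
  last by move=> i _; apply: hE.
have pos_order_n k : increasing k -> 0 < minor a n.+1 k g by move/pos_n; apply.
move=> E; rewrite -(pmulr_lgt0 _ (pos_order_n _ (increasing_succ h_inc))) E.
by rewrite addr_gt0 // mulr_gt0 // pos_order_n //; do ?apply: increasing_succ;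
   apply: increasing_bump.
Qed.

(** The row criterion is used twice: with contiguous columns it frees the rows, then on the
    transpose it frees the columns. *)
Lemma positive_minors_step a n :
  positive_minors a n -> positive_contiguous_minors a n.+1 ->
  positive_minors a n.+1.
Proof.
move=> pos_n pos_contig f g f_inc g_inc.
rewrite -minor_tr; apply: positive_minors_contiguous_rows => // [h k *|s].
  by rewrite minor_tr; apply: pos_n.
rewrite minor_tr; apply: positive_minors_contiguous_rows => //.
exact: increasing_shift.
Qed.

End Fekete.

(** * Toeplitz minors *)

Definition toeplitz (R : Type) (c : int -> R) (m n : int) := c (m - n).

Lemma TP_positive_minors (R : realType) k (c : int -> R) :
  TP_Polya_frequency k c <->
  (forall r, (r <= k)%N -> positive_minors (toeplitz c) r).
Proof.
split=> [tp [|r] le_rk f g f_inc g_inc|pos [//|r] le_rk m n m_inc n_inc].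
- by rewrite minor0.
- apply: (tp r.+1 le_rk (fun i => f i) (fun j => g j)) => i j lt_ij.
    exact: f_inc.
  exact: g_inc.
(* Past [r] the finite sequence continues by unit steps from its last value; [minn] keeps the
   argument of [inord] in range. *)
pose extend (h : 'I_r.+1 -> int) t := h (inord (minn t r)) + (t - r)%N%:Z.
have extend_inc h : strictly_increasing h -> increasing (extend h).
  move=> h_inc i j lt_ij; rewrite /extend.
  have [lt_ir|le_ri] := ltnP i r.
    have : h (inord i) < h (inord (minn j r)).
      by apply: h_inc; rewrite !inordK; lia.
    by move/ltr_leD; apply; rewrite lez_nat; lia.
  have -> : minn j r = r by lia.
  by rewrite ltrD2l ltz_nat; lia.
have extendE h (i : 'I_r.+1) : extend h i = h i.
  have le_ir := ltn_ord i; rewrite /extend.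
  have -> : minn i r = i by lia.
  by rewrite inord_val (_ : (i - r)%N = 0%N) ?addr0; lia.
have := pos r.+1 le_rk _ _ (extend_inc m m_inc) (extend_inc n n_inc).
congr (0 < \det _); apply/matrixP => i j.
by rewrite !mxE !extendE.
Qed.

(** * Principal minors and sign non-reversal *)

Lemma det_add_diagonal_entry (R : comPzRingType) n (A : 'M[R]_n.+1) m x :
  \det (A + x *: delta_mx m m) = \det A + x * \det (row' m (col' m A)).
Proof.
(* Cofactors along row [m] ignore row [m], so the determinant is affine in the entry [(m, m)]. *)
have cof j : cofactor (A + x *: delta_mx m m) m j = cofactor A m j.
  rewrite /cofactor; congr (_ * \det _); apply/matrixP => i k.
  by rewrite !mxE [_ == m]eq_sym (negPf (neq_lift _ _)) mulr0 addr0.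
rewrite !(expand_det_row _ m).
under eq_bigr do rewrite cof !mxE eqxx mulrDl.
rewrite big_split /=; congr (_ + _).
rewrite (bigD1 m) //= big1 ?addr0 => [|j /negPf->]; last by rewrite mulr0 mul0r.
by rewrite eqxx mulr1 /cofactor addnn -signr_odd odd_double expr0 mul1r.
Qed.

(* The determinant of [A + D], D diagonal, is a combination of principal minors
   of A whose coefficients are products of entries of D. *)
Lemma det_add_diagonal_gt0 (R : numDomainType) n (a : nat -> nat -> R)
    (d : 'I_n -> R) :
  (forall r (f : nat -> nat), (r <= n)%N -> {homo f : i j / (i < j)%N} ->
    0 < minor a r f f) ->
  (forall i, 0 <= d i) ->
  0 < \det (\matrix_(i < n, j < n) (a i j + d i *+ (i == j))).
Proof.
elim: n a d => [|n IHn] a d pos_a d_ge0; first by rewrite det_mx00.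
(* The diagonal terms are added one at a time: [A m] carries the first [m]. *)
pose A m :=
  \matrix_(i < n.+1, j < n.+1) (a i j + d i *+ ((i == j) && (i < m)%N)).
suff: 0 < \det (A n.+1).
  congr (0 < \det _); apply/matrixP => i j.
  by rewrite !mxE ltn_ord andbT.
suff: forall m, (m <= n.+1)%N -> 0 < \det (A m) by apply.
elim=> [_|m IHm lt_mn].
  have := pos_a n.+1 id (leqnn _) (fun i j => id).
  congr (0 < \det _); apply/matrixP => i j.
  by rewrite !mxE andbF addr0.
pose m' := Ordinal lt_mn.
have -> : A m.+1 = A m + d m' *: delta_mx m' m'.
  apply/matrixP => i j; rewrite !mxE -addrA; congr (_ + _).
  have [<-|] := eqVneq i j; last first.
    move=> ne_ij; case: eqP => [eim|]; last by rewrite mulr0 addr0.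
    by rewrite -eim eq_sym (negPf ne_ij) mulr0 addr0.
  rewrite andbb ltnS leq_eqVlt -val_eqE /=.
  have [eim|_] := eqVneq (i : nat) m; last by rewrite mulr0 addr0.
  by rewrite eim ltnn add0r mulr1; congr d; apply: val_inj.
rewrite det_add_diagonal_entry ltr_wpDr ?IHm ?mulr_ge0 ?(ltnW lt_mn) //.
(* Deleting row and column [m] leaves a matrix of the same kind and of order [n]; [d'] is its
   diagonal, zero from index [m] on. *)
pose d' i := d (lift m' i) *+ (bump m i < m)%N.
have := IHn (fun i j => a (bump m i) (bump m j)) d'.
have -> : row' m' (col' m' (A m)) =
    \matrix_(i < n, j < n) (a (bump m i) (bump m j) + d' i *+ (i == j)).
  apply/matrixP => i j; rewrite !mxE /= (inj_eq lift_inj) /d'.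
  by case: (i == j); rewrite ?mulr1n ?mulr0n.
move=> IH; apply/ltW/IH => [r f le_rn f_inc|i]; last exact: mulrn_wge0.
apply: (pos_a r (bump m \o f)); first exact: leqW.
by move=> i j /f_inc; rewrite /= /bump; lia.
Qed.

(* If [x_j (A x)_j <= 0] for all j, then [A + D] kills x for the nonnegative
   diagonal matrix D with entries [- (A x)_j / x_j]. *)
Lemma P_matrix_sign_non_reversal (R : realFieldType) n (a : nat -> nat -> R)
    (x : 'cV[R]_n) :
  (0 < n)%N ->
  (forall r (f : nat -> nat), (r <= n)%N -> {homo f : i j / (i < j)%N} ->
    0 < minor a r f f) ->
  (forall i, x i 0 != 0) ->
  exists j0 : 'I_n, 0 < x j0 0 * \sum_(j < n) a j0 j * x j 0.
Proof.
move=> n_gt0 pos_a x_neq0.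
pose Ax (i : 'I_n) := \sum_(j < n) a i j * x j 0.
have [/existsP //|/existsPn non_pos] := boolP [exists i, 0 < x i 0 * Ax i].
pose d i := - (Ax i / x i 0).
have d_ge0 i : 0 <= d i.
  have -> : d i = - (x i 0 * Ax i) / x i 0 ^+ 2.
    by rewrite /d expr2 invfM mulNr mulrACA mulfV // mul1r.
  by rewrite divr_ge0 ?sqr_ge0 // oppr_ge0 leNgt non_pos.
have det_gt0 := det_add_diagonal_gt0 pos_a d_ge0.
set B := \matrix_(i, j) _ in det_gt0.
have Bx0 : B *m x = 0.
  apply/colP => i; rewrite !mxE.
  under eq_bigr do rewrite mxE mulrDl.
  rewrite big_split /= -/(Ax i) [X in _ + X](bigD1 i) //= eqxx mulr1n.
  rewrite big1 => [|j /negPf ne_ji]; last by rewrite eq_sym ne_ji mul0r.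
  by rewrite addr0 /d mulNr divfK // subrr.
have B_unit : B \in unitmx by rewrite unitmxE unitfE gt_eqF.
have := x_neq0 (Ordinal n_gt0).
by rewrite -(mulKmx B_unit x) Bx0 mulmx0 mxE eqxx.
Qed.

Theorem corollary1p6 (R : realType) (k : nat) (hk : (1 <= k)%N) (c : int -> R) :
  TP_Polya_frequency k c <->
  (forall (r : nat) (l : int), (1 <= r <= k)%N ->
   forall x : 'cV[R]_r, alternating x ->
   exists j0 : 'I_r,
     0 < x j0 0 * \sum_(j < r) c (l + j0%:Z - j%:Z) * x j 0).
Proof.
rewrite TP_positive_minors; split.
  move=> pos r l /andP[r_gt0 le_rk] x [x_neq0 _].
  pose a (i j : nat) := c (l + i%:Z - j%:Z).
  (* The principal minor of [a] on [f] is the Toeplitz minor with rows [l + f i] and columns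
     [f j]. *)
  apply: (P_matrix_sign_non_reversal (a := a)) => // q f le_qr f_inc.
  apply: (pos q (leq_trans le_qr le_rk) (fun i => l + (f i)%:Z)
                                        (fun j => (f j)%:Z)).
    by move=> i j /f_inc lt_f; rewrite ltrD2l ltz_nat.
  by move=> i j /f_inc lt_f; rewrite ltz_nat.
move=> snr; elim=> [_ f g _ _|r IHr lt_rk]; first by rewrite minor0.
have pos_r := IHr (ltnW lt_rk).
apply: positive_minors_step => // s t.
pose f i := s + i%:Z; pose g i := t + i%:Z.
pose A := \matrix_(i < r.+1, j < r.+1) toeplitz c (f i) (g j).
pose x := col 0 (\adj A).
pose M j := minor (toeplitz c) r (f \o succn) (g \o bump j).
have xE j : x j 0 = (-1) ^+ j * M j.
  by rewrite !mxE (cofactor_minor (toeplitz c) f g).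
have M_gt0 j : 0 < M j.
  by apply: pos_r; [apply: increasing_succ|apply: increasing_bump];
     apply: increasing_shift.
have sg_x j : Num.sg (x j 0) = (-1) ^+ j.
  by rewrite xE sgrM (gtr0_sg (M_gt0 j)) mulr1 sgrX sgrN1.
have x_alt : alternating x.
  split=> [i|i j eji]; first by rewrite -sgr_eq0 sg_x signr_eq0.
  by rewrite !sg_x eji exprS mulN1r.
(* The shift is [s - t] because [(s + i) - (t + j) = (s - t) + i - j]. *)
have [j0] := snr r.+1 (s - t) lt_rk x x_alt.
have -> : \sum_(j < r.+1) c (s - t + j0%:Z - j%:Z) * x j 0 =
           \det A *+ (j0 == 0).
  have := mul_mx_adj A => /matrixP/(_ j0 0); rewrite !mxE => <-.
  apply: eq_bigr => j _; rewrite !mxE /toeplitz /f /g; congr (c _ * _).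
  by rewrite opprD addrACA addrA.
(* A nonzero [j0] would give [0 < 0]; at [j0 = 0] the factor [x 0 0 = M 0] is positive and
   cancels. *)
case: eqP => [->|_]; last by rewrite mulr0 ltxx.
by rewrite mulr1n xE expr0 mul1r pmulr_rgt0.
Qed.
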